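(* Let $(\mathbf r,\mathbf h)$ be a pattern, with $\mathbf r=(r_1,\dots,r_t)$ and $\mathbf h=(h_1,\dots,h_t)$, and let $H=\sum_{j=1}^t h_j$ and $B=\sum_{j=1}^t h_j|r_j|$. Assume that $p\neq q$ are primes such that $p>B$, $q>B$, $p\nmid r_1\cdots r_t$ and $q\nmid r_1\cdots r_t$. Then $$T^{(pq;p)}_{\mathbf r,\mathbf h}(\alpha_{1,pq},\dots,\alpha_{pq-1,pq})=q\,\mathsf S_0(\mathbf r,\mathbf h)-2^H,$$ $$T^{(pq;q)}_{\mathbf r,\mathbf h}(\alpha_{1,pq},\dots,\alpha_{pq-1,pq})=p\,\mathsf S_0(\mathbf r,\mathbf h)-2^H,$$ $$T^{(pq;1)}_{\mathbf r,\mathbf h}(\alpha_{1,pq},\dots,\alpha_{pq-1,pq})=\bigl((p-1)(q-1)-1\bigr)\mathsf S_0(\mathbf r,\mathbf h)+2^H.$$ Consequently, $$T^{(pq)}_{\mathbf r,\mathbf h}(\alpha_{1,pq},\dots,\alpha_{pq-1,pq})=pq\,\mathsf S_0(\mathbf r,\mathbf h)-2^H.$$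
   Context: A pattern $(\mathbf r,\mathbf h)$ consists of an integer $t\ge 1$, a tuple $\mathbf r=(r_1,\dots,r_t)$ of nonzero integers with $r_1=1$, and a tuple $\mathbf h=(h_1,\dots,h_t)$ of nonnegative integers. For $n\ge 2$ put $\Omega_n=\{1,\dots,n-1\}$ and $\alpha_{k,n}=\cos(2\pi k/n)$ for $k\in\Omega_n$. For an integer $r$ with $\gcd(r,n)=1$, let $\sigma_r:\Omega_n\to\Omega_n$ be the permutation determined by $\sigma_r(k)\equiv rk\pmod n$. For $d\mid n$, $d<n$, put $\mathcal O_d(n)=\{k\in\Omega_n:\gcd(k,n)=d\}$. When $\gcd(n,r_1\cdots r_t)=1$, define $$T^{(n)}_{\mathbf r,\mathbf h}(x_1,\dots,x_{n-1})=\sum_{k\in\Omega_n}\prod_{j=1}^t\bigl(2x_{\sigma_{r_j}(k)}\bigr)^{h_j},\qquad T^{(n;d)}_{\mathbf r,\mathbf h}(x_1,\dots,x_{n-1})=\sum_{k\in\mathcal O_d(n)}\prod_{j=1}^t\bigl(2x_{\sigma_{r_j}(k)}\bigr)^{h_j}.$$ $\mathsf S_0(\mathbf r,\mathbf h)$ denotes the constant coefficient (coefficient of $u^0$) of the Laurent polynomial $\prod_{j=1}^t(u^{r_j}+u^{-r_j})^{h_j}$. *)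

(* Defs.v *)
From HB Require Import structures.
From mathcomp Require Import all_boot all_order all_algebra.
From mathcomp Require Import all_classical all_reals all_analysis.

Set Implicit Arguments.
Unset Strict Implicit.
Unset Printing Implicit Defensive.

Import Order.TTheory GRing.Theory Num.Theory.
Local Open Scope ring_scope.

Definition is_pattern (t : nat) (r : t.-tuple int) (h : t.-tuple nat) : Prop :=
  [/\ (1 <= t)%N, forall j : 'I_t, tnth r j != 0 & r`_0 = 1].

Definition pattern_H (t : nat) (h : t.-tuple nat) : nat :=
  (\sum_(j < t) tnth h j)%N.

Definition pattern_B (t : nat) (r : t.-tuple int) (h : t.-tuple nat) : nat :=
  (\sum_(j < t) tnth h j * `|tnth r j|)%N.

(* {1, ..., n-1}, each element keeping its own value as an ordinal below n *)
Record Omega (n : nat) := MkOmega {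
  omega_ord :> 'I_n;
  omega_gt0 : (0 < omega_ord)%N
}.

HB.instance Definition _ n := [isSub for @omega_ord n].
HB.instance Definition _ n := [Countable of Omega n by <:].
HB.instance Definition _ n := [Finite of Omega n by <:].

Definition alpha (R : realType) (n : nat) (k : Omega n) : R :=
  cos (2 * pi * k%:R / n%:R).

(* Meaningful only for r coprime to n: the l below then exists (sigmaE), and
   sigma r permutes Omega n (sigma_inj). *)
Definition sigma (n : nat) (r : int) (k : Omega n) : Omega n :=
  odflt k [pick l : Omega n | (l%:Z == r * k%:Z %[mod n%:Z])%Z].

Definition orbit_gcd (n d : nat) : {set Omega n} :=
  [set k : Omega n | gcdn k n == d].

Definition Tsum (A : comNzRingType) (t : nat) (r : t.-tuple int)
    (h : t.-tuple nat) (n : nat) (x : Omega n -> A) : A :=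
  \sum_(k : Omega n) \prod_(j < t) (2 * x (sigma (tnth r j) k)) ^+ tnth h j.

Definition Tsum_gcd (A : comNzRingType) (t : nat) (r : t.-tuple int)
    (h : t.-tuple nat) (n d : nat) (x : Omega n -> A) : A :=
  \sum_(k in orbit_gcd n d)
    \prod_(j < t) (2 * x (sigma (tnth r j) k)) ^+ tnth h j.

(* The ring Z[u, u^-1] of Laurent polynomials is taken inside the fraction field
   Q(u) of Z[u], as the set of elements p(u) / u^N. *)
Definition Qu : fieldType := {fraction {poly int}}.

Definition toQu (p : {poly int}) : Qu := tofrac p.

Fact toQu_is_zmod_morphism : zmod_morphism toQu.
Proof. exact: tofracB. Qed.

Fact toQu_is_monoid_morphism : monoid_morphism toQu.
Proof. by split; [exact: tofrac1 | exact: tofracM]. Qed.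

HB.instance Definition _ :=
  GRing.isZmodMorphism.Build {poly int} Qu toQu toQu_is_zmod_morphism.
HB.instance Definition _ :=
  GRing.isMonoidMorphism.Build {poly int} Qu toQu toQu_is_monoid_morphism.

Lemma toQu_eq (p q : {poly int}) : (toQu p == toQu q) = (p == q).
Proof. exact: tofrac_eq. Qed.

Definition laurent_u : Qu := toQu 'X.

(* Depends only on f when f is a Laurent polynomial (const_coefE), and is 0 for
   the other elements of Q(u). *)
Definition const_coef (f : Qu) : int :=
  xget 0 [set c : int | exists (N : nat) (p : {poly int}),
            f = toQu p / laurent_u ^+ N /\ c = p`_N]%classic.

Definition S0 (t : nat) (r : t.-tuple int) (h : t.-tuple nat) : int :=
  const_coef (\prod_(j < t)
    (laurent_u ^ tnth r j + laurent_u ^ (- tnth r j)) ^+ tnth h j).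

Lemma sigmaE (n : nat) (r : int) (k : Omega n) :
  coprimez r n%:Z -> (sigma r k = r * k%:Z %[mod n%:Z])%Z.
Proof.
move=> rn; rewrite /sigma; case: pickP => [l /eqP //|no].
have n_gt0 : (0 < n)%N by apply: leq_ltn_trans (ltn_ord k).
have n0 : n%:Z != 0 by rewrite eqz_nat -lt0n.
pose m := (r * k%:Z %% n%:Z)%Z.
have mE : `|m|%N%:Z = m by rewrite gez0_abs // modz_ge0.
have m_lt : (`|m| < n)%N by rewrite -ltz_nat mE ltz_pmod.
have m_gt0 : (0 < Ordinal m_lt)%N.
  rewrite lt0n /= absz_eq0; apply/eqP => /dvdz_mod0P.
  rewrite Gauss_dvdzr 1?coprimez_sym // dvdzE !absz_nat.
  by rewrite gtnNdvd ?ltn_ord ?omega_gt0.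
by have := no (MkOmega m_gt0); rewrite /= mE modz_mod eqxx.
Qed.

Lemma sigma_inj (n : nat) (r : int) :
  coprimez r n%:Z -> injective (@sigma n r).
Proof.
move=> rn k l kl; apply/val_inj/val_inj => /=.
have := sigmaE l rn; rewrite -kl (sigmaE k rn) => /eqP.
rewrite eqz_mod_dvd -mulrBr Gauss_dvdzr 1?coprimez_sym // -eqz_mod_dvd.
by rewrite !modz_small ?ltz_nat ?ltn_ord // => /eqP [].
Qed.

Lemma const_coefE (p : {poly int}) (N : nat) :
  const_coef (toQu p / laurent_u ^+ N) = p`_N.
Proof.
have u0 n : laurent_u ^+ n != 0.
  by rewrite expf_neq0 // -(rmorph0 toQu) toQu_eq polyX_eq0.
rewrite /const_coef; case: xgetP => [c _ [M [q [/eqP + ->]]]|]; last first.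
  by move=> /(_ p`_N) []; exists N, p.
rewrite eqr_div // -!rmorphXn -!rmorphM toQu_eq => /eqP pq.
have := congr1 (fun s : {poly int} => s`_(M + N)) pq.
by rewrite !coefMXn ltnNge leq_addr /= ltnNge leq_addl /= addnK addKn.
Qed.

(* Main.v *)
(* By definition of [sigma], the term of index [k] is the value at
   [u = exp (2 i pi k / n)] of the Laurent polynomial
   [\prod_j (u ^ r_j + u ^ (- r_j)) ^+ h_j], whose exponents lie between [- B]
   and [B]. For [B < m], summing over all [m]-th roots of unity kills every
   monomial but the constant one, so the sum is [m * S0]; dropping [u = 1]
   removes [2 ^+ H]. With [m = p * q] this is the full sum, with [m = q] and
   [m = p] it gives the orbits of gcd [p] and [q], since these indices run over
   the nontrivial [q]-th and [p]-th roots of unity; the orbit of gcd 1 is what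
   remains. The computation is carried out on real parts: a polynomial [P]
   divided by [u ^+ b] becomes the combination of the [cos ((i - b) x)] with the
   coefficients of [P]. *)
Require Import Defs.
From HB Require Import structures.
From mathcomp Require Import all_boot all_order all_algebra.
From mathcomp Require Import all_classical all_reals all_analysis.
From mathcomp Require Import ring zify.
Import Order.TTheory GRing.Theory Num.Theory.
Local Open Scope ring_scope.

(** * Cosine sums and combinations of cosines with polynomial coefficients *)

Section CosineSums.
Variable R : realType.
Implicit Types (m k n : nat) (z : int) (x y : R) (P : {poly int}).

Lemma cosD2piz x z : cos (x + 2 * pi * z%:~R) = cos x.
Proof.
have E n : 2 * pi * n%:R = (pi *+ 2) *+ n :> R by rewrite mulr_natr mulr_natl.
case: z => n; rewrite ?NegzE ?rmorphN /= ?mulrN -pmulrn E.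
  by rewrite (periodicn (@cosD2pi R)).
by rewrite -[LHS](periodicn (@cosD2pi R) n.+1) subrK.
Qed.

Lemma cos_absz z x : cos (`|z|%N%:R * x) = cos (z%:~R * x).
Proof.
by case: z => n //=; rewrite NegzE rmorphN mulNr cosN.
Qed.

(* Multiplied by twice the sine of half the common difference of the angles, the
   sum telescopes. *)
Lemma cos_sum_eq0 n m : (0 < m < n)%N ->
  \sum_(k < n) cos (m%:R * (2 * pi * k%:R / n%:R)) = 0 :> R.
Proof.
case/andP=> m0 mn.
have n_gt0 : (0 < n)%N := ltn_trans m0 mn.
have n0 : n%:R != 0 :> R by rewrite pnatr_eq0 -lt0n.
pose y : R := pi * (m%:R / n%:R).
have y_in : 0 < y < pi.
  rewrite mulr_gt0 ?pi_gt0 ?divr_gt0 ?ltr0n //=.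
  by rewrite gtr_pMr ?pi_gt0 // ltr_pdivrMr ?ltr0n // mul1r ltr_nat.
have siny : 2 * sin y != 0.
  by rewrite mulf_neq0 ?pnatr_eq0 // gt_eqF ?sin_gt0_pi.
apply: (mulfI siny); rewrite mulr0 big_distrr /=.
pose F k : R := sin (y * (2 * k%:R - 1)).
rewrite (eq_bigr (fun k : 'I_n => F k.+1 - F k)) => [|k _].
  rewrite -(big_mkord xpredT (fun k => F k.+1 - F k)) telescope_sumr // /F.
  (* The last angle is the first one, [- y], plus [m] full turns, so the two ends of the telescoped
     sum cancel. *)
  have -> : y * (2 * n%:R - 1) = - y + (pi *+ 2) *+ m.
    rewrite -mulr_natr -[pi *+ 2]mulr_natr /y; field.
    by rewrite n0.
  by rewrite (periodicn (@sinD2pi R)) mulr0 add0r mulrN1 subrr.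
have -> : m%:R * (2 * pi * k%:R / n%:R) = y * (2 * k%:R).
  by rewrite /y; field; rewrite n0.
rewrite /F -[k.+1%:R]natr1.
have -> : y * (2 * (k%:R + 1) - 1) = y * (2 * k%:R) + y by ring.
have -> : y * (2 * k%:R - 1) = y * (2 * k%:R) - y by ring.
by rewrite sinD sinB; ring.
Qed.

(** The additive map sending ['X^i] to [g i]. Keeping [g] arbitrary lets multiplication by ['X^m]
    act as a shift of [g]. *)
Definition coef_comb (g : nat -> R) P : R := \sum_(i < size P) (P`_i)%:~R * g i.

Lemma coef_comb_wide N g P : (size P <= N)%N ->
  coef_comb g P = \sum_(i < N) (P`_i)%:~R * g i.
Proof.
move=> PN; rewrite /coef_comb.
rewrite (big_ord_widen N (fun i => (P`_i)%:~R * g i)) // big_mkcond /=.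
by apply: eq_bigr => i _; case: ltnP => // /(nth_default 0) ->; rewrite mul0r.
Qed.

Lemma coef_combMXnD1 m g P :
  coef_comb g (('X^m + 1) * P) = coef_comb (fun i => g (m + i)%N + g i) P.
Proof.
have szX : (size ('X^m * P)%R <= m + size P)%N.
  by rewrite (leq_trans (size_polyMleq _ _)) // size_polyXn.
have szP : (size P <= m + size P)%N by rewrite leq_addl.
rewrite mulrDl mul1r (@coef_comb_wide (m + size P)%N); last first.
  by rewrite (leq_trans (size_polyD _ _)) // geq_max szX szP.
transitivity (\sum_(i < m + size P) (('X^m * P)`_i)%:~R * g i + coef_comb g P).
  rewrite (coef_comb_wide _ g _ szP) -big_split /=; apply: eq_bigr => i _.
  by rewrite coefD rmorphD mulrDl.
rewrite big_split_ord /= big1 => [|i _]; last first.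
  by rewrite coefXnM ltn_ord mul0r.
rewrite add0r /coef_comb -big_split /=; apply: eq_bigr => i _.
by rewrite coefXnM ltnNge leq_addr addKn mulrDr.
Qed.

(** At [u = exp (i x)], dividing [u ^ (2m) + 1] by [u ^ m] gives [2 cos (m x)]; on real parts this
    is [cos (a + c) + cos (a - c) = 2 cos a cos c]. *)
Lemma coef_comb_cosM m b x P :
  coef_comb (fun i => cos ((i%:R - (m + b)%:R) * x)) (('X^(2 * m) + 1) * P) =
  2 * cos (m%:R * x) * coef_comb (fun i => cos ((i%:R - b%:R) * x)) P.
Proof.
rewrite coef_combMXnD1 /coef_comb big_distrr /=; apply: eq_bigr => i _.
rewrite mulrCA; congr (_ * _).
have -> : ((2 * m + i)%:R - (m + b)%:R) * x = (i%:R - b%:R) * x + m%:R * x.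
  by rewrite natrD natrM natrD; ring.
have -> : (i%:R - (m + b)%:R) * x = (i%:R - b%:R) * x - m%:R * x.
  by rewrite natrD; ring.
by rewrite cosD cosB; ring.
Qed.

(** The integers [sigma z k] and [z * k] differ by a multiple of [n], so the angles differ by full
    turns. *)
Lemma alpha_sigma n z (k : Omega n) : coprimez z n ->
  alpha R (sigma z k) = cos (z%:~R * (2 * pi * k%:R / n%:R)).
Proof.
move=> zn; have /eqP := sigmaE k zn.
rewrite eqz_mod_dvd => /dvdzP[c /eqP]; rewrite subr_eq => /eqP skE.
have n0 : n%:R != 0 :> R.
  by rewrite pnatr_eq0 -lt0n (leq_ltn_trans _ (ltn_ord k)).
have sE : (sigma z k)%:R = c%:~R * n%:R + z%:~R * k%:R :> R.
  by rewrite pmulrn skE rmorphD !rmorphM.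
rewrite /alpha sE -[RHS](cosD2piz _ c); congr cos; field.
by rewrite n0.
Qed.

(** * The Laurent polynomial of a pattern and its values on the unit circle *)

Section Pattern.
Variables (t : nat) (r : t.-tuple int) (h : t.-tuple nat).

(* [u ^+ B * \prod_j (u ^ r_j + u ^ (- r_j)) ^+ h_j] as a polynomial in [u]. *)
Definition pattern_poly : {poly int} :=
  \prod_(j < t) ('X^(2 * `|tnth r j|%N) + 1) ^+ tnth h j.

Definition cos_prod x : R :=
  \prod_(j < t) (2 * cos ((tnth r j)%:~R * x)) ^+ tnth h j.

Lemma cos_prod0 : cos_prod 0 = 2 ^+ pattern_H h.
Proof.
rewrite /pattern_H -prodrXr; apply: eq_bigr => j _.
by rewrite mulr0 cos0 mulr1.
Qed.

Lemma size_pattern_poly : (size pattern_poly <= (2 * pattern_B r h).+1)%N.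
Proof.
rewrite /pattern_poly /pattern_B.
apply: (big_rec2 (fun P b => size P <= (2 * b).+1)%N) => [|j P b _ IH].
  by rewrite size_poly1.
rewrite (leq_trans (size_polyMleq _ _)) //.
set n := `|tnth r j|%N; set e := tnth h j.
have szX : (size ('X^(2 * n) + 1 : {poly int})%R <= (2 * n).+1)%N.
  by rewrite (leq_trans (size_polyD _ _)) // size_polyXn size_poly1; lia.
have szXe := size_poly_exp_leq ('X^(2 * n) + 1 : {poly int}) e.
by nia.
Qed.

(** Multiplication by [u ^ B] clears the denominators and moves the constant coefficient to degree
    [B]. *)
Lemma S0_pattern_poly : S0 r h = pattern_poly`_(pattern_B r h).
Proof.
have u0 : laurent_u != 0 by rewrite -(rmorph0 toQu) toQu_eq polyX_eq0.
rewrite -const_coefE /S0; congr const_coef.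
rewrite /pattern_poly /pattern_B rmorph_prod -prodrXr -prodf_div.
apply: eq_bigr => j _.
rewrite rmorphXn [(tnth h j * _)%N]mulnC [laurent_u ^+ _]exprM -expr_div_n.
congr (_ ^+ _); rewrite rmorphD rmorph1 rmorphXn -/laurent_u.
have absE n : laurent_u ^ (n : int) + laurent_u ^ (- n%:Z) =
    (laurent_u ^+ (2 * n) + 1) / laurent_u ^+ n.
  rewrite -exprnN -exprnP mul2n -addnn exprD mulrDl mulfK ?expf_neq0 //.
  by rewrite div1r.
(* The factor is invariant under [r_j -> - r_j], so absolute values suffice. *)
by case: (tnth r j) => n; rewrite ?NegzE ?abszN ?opprK /= -?absE // addrC.
Qed.

Lemma cos_prodE x :
  cos_prod x =
  coef_comb (fun i => cos ((i%:R - (pattern_B r h)%:R) * x)) pattern_poly.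
Proof.
rewrite /cos_prod /pattern_poly /pattern_B.
apply: (big_rec3 (fun v P b =>
  v = coef_comb (fun i => cos ((i%:R - b%:R) * x)) P)) => [|j v P b _ ->].
  by rewrite /coef_comb size_poly1 big_ord1 coef1 subrr mul0r cos0 mulr1.
(* Each of the [h_j] copies of the factor raises the shift [b] by [|r_j|]. *)
elim: (tnth h j) => [|e IHe]; first by rewrite mul0n !mul1r.
by rewrite !exprS -!mulrA mulSn -addnA coef_comb_cosM -IHe cos_absz !mulrA.
Qed.

Lemma cos_prod_sum n : (pattern_B r h < n)%N ->
  \sum_(k < n) cos_prod (2 * pi * k%:R / n%:R) = n%:R * (S0 r h)%:~R.
Proof.
set B := pattern_B r h => Bn.
have szP := size_pattern_poly.
under eq_bigr do rewrite cos_prodE (coef_comb_wide _ _ _ szP).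
rewrite exchange_big /=.
have iB : (B < (2 * B).+1)%N by lia.
(* Index [B] has frequency 0 and coefficient [S0 r h], so it contributes [n] times [S0 r h]. *)
rewrite (bigD1 (Ordinal iB)) //= [X in _ + X]big1 ?addr0 => [|i].
  rewrite -mulr_sumr /= -S0_pattern_poly mulrC; congr (_ * _).
  under eq_bigr do rewrite subrr mul0r cos0.
  by rewrite sumr_const card_ord.
(* Any other frequency satisfies [0 < |i - B| <= B < n], so its cosines sum to 0. *)
rewrite -val_eqE /= => ne_iB; rewrite -mulr_sumr /=.
have -> : i%:R - (pattern_B r h)%:R = (i%:Z - B%:Z)%:~R :> R by rewrite rmorphB.
under eq_bigr do rewrite -cos_absz.
by rewrite cos_sum_eq0 ?mulr0 //; have := ltn_ord i; lia.
Qed.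

Lemma prod_alpha_sigma n (k : Omega n) :
  (forall j, coprimez (tnth r j) n) ->
  \prod_(j < t) (2 * alpha R (sigma (tnth r j) k)) ^+ tnth h j =
  cos_prod (2 * pi * k%:R / n%:R).
Proof. by move=> rn; apply: eq_bigr => j _; rewrite alpha_sigma. Qed.

End Pattern.
End CosineSums.

(** * Reindexing of sums and description of the gcd orbits *)

Lemma sum_Omega (V : zmodType) n (P : pred nat) (F : nat -> V) :
  (0 < n)%N -> P 0%N ->
  \sum_(k : Omega n | P k) F k = \sum_(k < n | P k) F k - F 0%N.
Proof.
move=> n0 P0; rewrite [in RHS](bigD1 (Ordinal n0)) //= addrC addrK.
rewrite [RHS](reindex_omap (@omega_ord n) insub) => [|i /andP[_ i0]].
  apply: eq_bigl => k; rewrite -val_eqE /= -lt0n omega_gt0 andbT.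
  by rewrite valK eqxx andbT.
by rewrite insubT // lt0n.
Qed.

(** By induction on [q]: the block of [p] integers starting at [p * q] contains a single multiple of
    [p], its first element. *)
Lemma sum_dvdn (V : nmodType) p q (F : nat -> V) : (0 < p)%N ->
  \sum_(k < p * q | (p %| k)%N) F k = \sum_(l < q) F (p * l)%N.
Proof.
move=> p0; elim: q => [|q IHq]; first by rewrite muln0 !big_ord0.
rewrite -(big_mkord (fun k => p %| k)%N) mulnS addnC.
rewrite (@big_cat_nat _ _ _ (p * q)) ?leq_addr //=.
rewrite big_mkord IHq big_ord_recr /=.
congr (_ + _); rewrite -{1}[(p * q)%N]add0n big_addn addKn big_mkord.
rewrite (bigD1 (Ordinal p0)) ?dvdn_mulr //= add0n big1 ?addr0 // => i.
rewrite -val_eqE /= => /andP[]; rewrite dvdn_addl ?dvdn_mulr // => pi i0.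
by have := dvdn_leq _ pi; rewrite lt0n i0 leqNgt ltn_ord => /(_ isT).
Qed.

Lemma coprimez_prime_prod (t : nat) (r : t.-tuple int) p j :
  prime p -> ~~ (p%:Z %| \prod_(j < t) tnth r j)%Z -> coprimez (tnth r j) p.
Proof.
move=> p_pr; apply: contraR; rewrite /coprimez gcdzC -/(coprimez _ _).
rewrite coprimezE absz_nat prime_coprime // negbK => p_rj.
by rewrite (bigD1 j) //= dvdz_mulr // dvdzE.
Qed.

(** If [k = l * p], the bounds force [0 < l < q], so [l] is coprime to [q] and no further factor
    enters the gcd. *)
Lemma gcdn_eq_prime p q k : prime p -> prime q -> (0 < k < p * q)%N ->
  (gcdn k (p * q) == p) = (p %| k)%N.
Proof.
move=> p_pr q_pr /andP[k0 kpq]; apply/eqP/idP => [<-|/dvdnP[l kE]].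
  exact: dvdn_gcdl.
move: k0 kpq; rewrite kE mulnC muln_gt0 prime_gt0 //= => l0.
rewrite ltn_pmul2l ?prime_gt0 // => lq; rewrite -muln_gcdr.
suff /eqP -> : coprime l q by rewrite muln1.
by rewrite coprime_sym prime_coprime // gtnNdvd.
Qed.

Lemma orbit_gcd_prime p q (k : Omega (p * q)) : prime p -> prime q ->
  (k \in orbit_gcd (p * q) p) = (p %| k)%N.
Proof.
by move=> p_pr q_pr; rewrite inE gcdn_eq_prime // omega_gt0 ltn_ord.
Qed.

(** * Evaluation of the sums at the cosines *)

Section Evaluation.
Variables (R : realType) (t : nat) (r : t.-tuple int) (h : t.-tuple nat).

Lemma Tsum_alpha n : (pattern_B r h < n)%N ->
  (forall j, coprimez (tnth r j) n) ->
  Tsum r h (@alpha R n) = n%:R * (S0 r h)%:~R - 2 ^+ pattern_H h.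
Proof.
move=> Bn rn; rewrite /Tsum.
under eq_bigr do rewrite prod_alpha_sigma //.
rewrite (@sum_Omega _ n xpredT
  (fun k => cos_prod R t r h (2 * pi * k%:R / n%:R))) //.
  by rewrite cos_prod_sum // mulr0 mul0r cos_prod0.
exact: leq_ltn_trans Bn.
Qed.

Lemma Tsum_gcd_alpha_prime p q : prime p -> prime q ->
  (pattern_B r h < q)%N -> (forall j, coprimez (tnth r j) (p * q)%N) ->
  Tsum_gcd r h p (@alpha R (p * q)) =
  q%:R * (S0 r h)%:~R - 2 ^+ pattern_H h.
Proof.
move=> p_pr q_pr Bq rpq; rewrite /Tsum_gcd.
have p0 := prime_gt0 p_pr; have q0 := prime_gt0 q_pr.
under eq_bigr do rewrite prod_alpha_sigma //.
under eq_bigl do rewrite orbit_gcd_prime //.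
rewrite (@sum_Omega _ (p * q) (fun k => p %| k)%N
  (fun k => cos_prod R t r h (2 * pi * k%:R / (p * q)%:R))) ?muln_gt0 ?p0 //.
rewrite (@sum_dvdn _ p q
  (fun k => cos_prod R t r h (2 * pi * k%:R / (p * q)%:R))) //.
rewrite mulr0 mul0r cos_prod0 -(cos_prod_sum R t r h q Bq); congr (_ - _).
(* At [k = p * l] the angle [2 pi k / (p q)] is [2 pi l / q]. *)
apply: eq_bigr => l _; congr cos_prod; rewrite !natrM; field.
by rewrite !pnatr_eq0 -!lt0n p0 q0.
Qed.

Lemma Tsum_gcd_split (A : comNzRingType) p q (x : Omega (p * q) -> A) :
  prime p -> prime q -> p != q ->
  Tsum r h x = Tsum_gcd r h p x + (Tsum_gcd r h q x + Tsum_gcd r h 1 x).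
Proof.
move=> p_pr q_pr pq; rewrite /Tsum (bigID (mem (orbit_gcd (p * q) p))) /=.
congr (_ + _); rewrite (bigID (mem (orbit_gcd (p * q) q))) /=.
congr (_ + _); apply: eq_bigl => k; rewrite !inE.
  by case: eqP => //= ->; rewrite (negbTE pq).
have kpq : (0 < k < p * q)%N by rewrite omega_gt0 ltn_ord.
(* Forgetting that [k] lies in [Omega (p * q)] frees its type from [p * q], so that the product can
   be commuted. *)
move: (k : nat) kpq => {}k kpq; rewrite gcdn_eq_prime //.
have -> : (gcdn k (p * q) == q) = (q %| k)%N.
  by rewrite mulnC gcdn_eq_prime // mulnC.
rewrite -/(coprime _ _) coprimeMr.
by rewrite !(coprime_sym k) !prime_coprime.
Qed.

End Evaluation.

Theorem theorem4p11 (R : realType) (t : nat) (r : t.-tuple int)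
    (h : t.-tuple nat) (p q : nat)
    (pattern_rh : is_pattern r h)
    (p_prime : prime p) (q_prime : prime q) (p_neq_q : p != q)
    (B_lt_p : (pattern_B r h < p)%N) (B_lt_q : (pattern_B r h < q)%N)
    (p_ndvd_r : ~~ (p%:Z %| \prod_(j < t) tnth r j)%Z)
    (q_ndvd_r : ~~ (q%:Z %| \prod_(j < t) tnth r j)%Z) :
  [/\ Tsum_gcd r h p (@alpha R (p * q)) =
        q%:R * (S0 r h)%:~R - 2 ^+ pattern_H h,
      Tsum_gcd r h q (@alpha R (p * q)) =
        p%:R * (S0 r h)%:~R - 2 ^+ pattern_H h,
      Tsum_gcd r h 1 (@alpha R (p * q)) =
        ((p%:R - 1) * (q%:R - 1) - 1) * (S0 r h)%:~R + 2 ^+ pattern_H h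
    & Tsum r h (@alpha R (p * q)) =
        (p * q)%:R * (S0 r h)%:~R - 2 ^+ pattern_H h].
Proof.
have rpq j : coprimez (tnth r j) (p * q)%N.
  by rewrite PoszM coprimezMr !coprimez_prime_prod.
have Tp := Tsum_gcd_alpha_prime R t r h p q p_prime q_prime B_lt_q rpq.
have Tq : Tsum_gcd r h q (@alpha R (p * q)) =
    p%:R * (S0 r h)%:~R - 2 ^+ pattern_H h.
  by move: rpq; rewrite mulnC => rqp; apply: Tsum_gcd_alpha_prime.
have Tall : Tsum r h (@alpha R (p * q)) =
    (p * q)%:R * (S0 r h)%:~R - 2 ^+ pattern_H h.
  apply: Tsum_alpha => //; apply: leq_trans B_lt_p _.
  by rewrite leq_pmulr ?prime_gt0.
split=> //.
have := Tsum_gcd_split t r h R p q (@alpha R (p * q)) p_prime q_prime p_neq_q.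
(* The orbit of gcd 1 is obtained by subtraction, with [p q - p - q = (p - 1) (q - 1) - 1]. *)
rewrite Tall Tp Tq natrM addrA => /esym/(canRL (addKr _)) ->.
ring.
Qed.
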